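(* Let $a$ be any integer and let $n$ be a positive odd integer. Then, for indeterminates $x$ and $q$ (equivalently, for all complex $x$ and all nonzero complex $q$), $$\det\left[x+q^{\lfloor \frac{aj-(a+1)k}{n}\rfloor}\right]_{1\leqslant j,k\leqslant n}=\left(\frac{a(a+1)}{n}\right)q^{(1-3n)/2}(1-q)^{n-1}(1+qx)$$ and $$\det\left[x+q^{\lceil \frac{(a+1)j-ak}{n}\rceil}\right]_{1\leqslant j,k\leqslant n}=\left(\frac{a(a+1)}{n}\right)q^{(n-1)/2}(1-q)^{n-1}(x+q).$$
   Context: $\lfloor x\rfloor$ is the largest integer not exceeding $x$ and $\lceil x\rceil$ is the least integer not smaller than $x$. $\left(\frac{\cdot}{n}\right)$ denotes the Jacobi symbol modulo the positive odd integer $n$ (equal to $0$ when the argument is not coprime to $n$, and $\left(\frac{\cdot}{1}\right)=1$). *)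

(* Defs.v *)
From HB Require Import structures.
From mathcomp Require Import all_boot all_order all_algebra.
Set Implicit Arguments. Unset Strict Implicit. Unset Printing Implicit Defensive.
Import Order.TTheory GRing.Theory Num.Theory.
Local Open Scope ring_scope.

Definition legendre (a : int) (p : nat) : int :=
  if (p%:Z %| a)%Z then 0
  else if [exists x : 'I_p, (p%:Z %| (x%:Z ^+ 2 - a))%Z] then 1 else -1.

Definition jacobi (a : int) (n : nat) : int :=
  \prod_(p <- primes n) legendre a p ^+ logn p n.

Definition floorz (m : int) (n : nat) : int := (m %/ n%:Z)%Z.
Definition ceilz (m : int) (n : nat) : int := - ((- m) %/ n%:Z)%Z.

(* Main.v *)
Require Import Defs.
From HB Require Import structures.
From mathcomp Require Import all_boot all_order all_algebra.
From mathcomp Require Import all_fingroup finfield.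
From mathcomp Require Import zify ring.
Import Order.TTheory GRing.Theory Num.Theory.
Local Open Scope ring_scope.

(** Write a j = n u_j + r_j and (a+1) k = n v_k + s_k with remainders in
    [0, n). The exponent is then u_j - v_k - [r_j < s_k], so when a and a+1 are
    prime to n the matrix is, up to diagonal factors and row and column
    permutations, a rank-one perturbation of the matrix B with entries 1/q
    above the diagonal and 1 elsewhere. Here det B = (1 - 1/q)^(n-1), and the
    matrix determinant lemma reduces the perturbation to a sum over the lattice
    (a+1) k = a j mod n, which telescopes to q - 1 because the lattice meets
    the boundary of the square [0, n]^2 only at its corners. The signs of the
    two permutations combine to the Jacobi symbol by Zolotarev's lemma, proved
    for affine maps mod n by splitting off one prime factor at a time. If a or
    a+1 has a common prime factor p >= 3 with n, three rows or columns are
    proportional up to the constant x, and both sides vanish. The second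
    identity is the transpose of the first with 1/q in place of q. *)

(** * Signs of permutations assembled from blocks *)

(** Writing [s] as a product of transpositions and carrying each of them along [f] factors [s'] into
    equally many transpositions. *)
Lemma odd_perm_embed {T T' : finType} (f : T -> T') (s : {perm T})
    (s' : {perm T'}) :
  injective f -> (forall x, s' (f x) = f (s x)) ->
  (forall y, y \notin codom f -> s' y = y) -> odd_perm s' = odd_perm s.
Proof.
move=> inj_f s'f s'id; have [ts def_s dts] := prod_tpermP s.
pose ts' := [seq (f t.1, f t.2) | t <- ts].
have dts' : all dpair ts'.
  rewrite all_map; apply: sub_all dts => t /=.
  by rewrite /dpair /= inj_eq.
have ts'f x : (\prod_(t <- ts') tperm t.1 t.2)%g (f x)
    = f ((\prod_(t <- ts) tperm t.1 t.2)%g x).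
  rewrite /ts'; elim: (ts) x => [|t r IHr] x /=.
    by rewrite !big_nil !perm1.
  by rewrite !big_cons !permM /= -inj_tperm // IHr.
have ts'id y : y \notin codom f -> (\prod_(t <- ts') tperm t.1 t.2)%g y = y.
  move=> fy; rewrite /ts'; elim: (ts) => [|t r IHr] /=.
    by rewrite !big_nil !perm1.
  rewrite !big_cons !permM /= tpermD ?IHr //.
    by apply: contraNneq fy => <-; apply: codom_f.
  by apply: contraNneq fy => <-; apply: codom_f.
have -> : s' = (\prod_(t <- ts') tperm t.1 t.2)%g.
  apply/permP=> y; have [/codomP[x ->]|fy] := boolP (y \in codom f).
    by rewrite s'f ts'f -def_s.
  by rewrite s'id // ts'id.
by rewrite def_s !odd_perm_prod // size_map.
Qed.

Lemma odd_perm_fibers {I T T' : finType} (e : I -> T -> T')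
    (s : I -> {perm T}) (s' : {perm T'}) :
  (forall i j x y, e i x = e j y -> i = j /\ x = y) ->
  (forall i x, s' (e i x) = e i (s i x)) ->
  (forall y, (forall i x, y <> e i x) -> s' y = y) ->
  odd_perm s' = \big[addb/false]_i odd_perm (s i).
Proof.
move=> inj_e s'e s'id.
(* Generalized to permutations moving only the blocks listed in [r], so that blocks can be peeled
   off one at a time. *)
suff fibers r : forall t : {perm T'}, uniq r ->
    (forall i x, i \in r -> t (e i x) = e i (s i x)) ->
    (forall y, (forall i x, i \in r -> y <> e i x) -> t y = y) ->
    odd_perm t = \big[addb/false]_(i <- r) odd_perm (s i).
  apply: fibers; rewrite ?index_enum_uniq // => y ey.
  by apply: s'id => i x; apply: ey; rewrite mem_index_enum.
elim: r => [|i r IHr] t /=.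
  move=> _ _ tid; have -> : t = 1%g by apply/permP=> y; rewrite perm1 tid.
  by rewrite big_nil odd_perm1.
case/andP=> ir ur te tid.
have inj_ei : injective (e i) by move=> x y /inj_e[].
(* [g] acts as [s i] on block [i] and trivially elsewhere; dividing it out of [t] leaves a
   permutation supported on the remaining blocks. *)
pose g y := if [pick x | e i x == y] is Some x then e i (s i x) else y.
have ge x : g (e i x) = e i (s i x).
  rewrite /g; case: pickP => [z /eqP/inj_ei -> //|/(_ x)]; by rewrite eqxx.
have gid y : y \notin codom (e i) -> g y = y.
  rewrite /g; case: pickP => // z /eqP <- /negP[]; exact: codom_f.
have inj_g : injective g.
  move=> y z.
  have [/codomP[y' ->]|ey] := boolP (y \in codom (e i));
    have [/codomP[z' ->]|ez] := boolP (z \in codom (e i)).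
  - by rewrite !ge => /inj_ei/perm_inj ->.
  - by rewrite ge (gid z) // => def_z; rewrite -def_z codom_f in ez.
  - by rewrite ge (gid y) // => def_y; rewrite def_y codom_f in ey.
  - by rewrite !gid.
pose u := perm inj_g.
have uV y z : u z = y -> (u^-1)%g y = z by move=> <-; rewrite permK.
rewrite -[t](mulKVg u) odd_permM big_cons.
congr (_ (+) _).
  apply: (odd_perm_embed (e i)) => // x; first by rewrite permE ge.
  by rewrite permE; apply: gid.
apply: IHr => // [j x jr|y ey]; rewrite permM.
  rewrite (uV _ (e j x)); first by rewrite te // inE jr orbT.
  rewrite permE gid //; apply/codomP=> [[x' /inj_e[ji _]]].
  by rewrite -ji jr in ir.
have [/codomP[x ->]|eiy] := boolP (y \in codom (e i)).
  rewrite (uV _ (e i ((s i)^-1%g x))); last by rewrite permE ge permKV.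
  by rewrite te ?inE ?eqxx // permKV.
rewrite (uV _ y); last by rewrite permE gid.
apply: tid => j x; rewrite inE => /orP[/eqP ->|]; last exact: ey.
by move=> def_y; rewrite def_y codom_f in eiy.
Qed.

Lemma big_addb_const {I : finType} (b : bool) :
  \big[addb/false]_(i : I) b = odd #|I| && b.
Proof.
rewrite big_const; elim: #|I| => //= k ->.
by case: b; case: (odd k).
Qed.

(** [s] is the map from [e i j] to [e i (g j)], made of [#|I|] disjoint copies of [g], followed by a
    permutation inside each fiber over [J]; the parities add. *)
Lemma odd_perm_wreath {I J T : finType} (e : I -> J -> T)
    (f : J -> {perm I}) (g : {perm J}) (s : {perm T}) :
  (forall i i' j j', e i j = e i' j' -> i = i' /\ j = j') ->
  (forall y, exists i, exists j, y = e i j) ->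
  (forall i j, s (e i j) = e (f j i) (g j)) ->
  odd_perm s
  = (odd #|I| && odd_perm g) (+) \big[addb/false]_j odd_perm (f j).
Proof.
move=> inj_e surj_e se.
have surj y : {ij : I * J | y = e ij.1 ij.2}.
  suff: exists ij : I * J, y == e ij.1 ij.2.
    by move/sigW=> [ij /eqP]; exists ij.
  by have [i [j ->]] := surj_e y; exists (i, j).
pose h y := let ij := sval (surj y) in e ij.1 (g ij.2).
have he i j : h (e i j) = e i (g j).
  by rewrite /h; case: (surj _) => -[i' j'] /= /inj_e[<- <-].
have inj_h : injective h.
  move=> y z; have [i [j ->]] := surj_e y; have [i' [j' ->]] := surj_e z.
  by rewrite !he => /inj_e[<- /perm_inj <-].
pose u := perm inj_h; rewrite -[s](mulKVg u) odd_permM.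
congr (_ (+) _).
  rewrite (odd_perm_fibers e (fun=> g)) ?big_addb_const //.
    by move=> i x; rewrite permE he.
  by move=> y ey; have [i [j /ey]] := surj_e y.
rewrite (odd_perm_fibers (fun j i => e i j) (fun j => f (g^-1%g j))).
- by rewrite (reindex_inj (@perm_inj _ g)); apply: eq_bigr => j _; rewrite permK.
- by move=> j j' i i' /inj_e[-> ->].
- move=> j i; rewrite permM.
  have -> : e i j = u (e i (g^-1%g j)) by rewrite permE he permKV.
  by rewrite permK se permKV.
by move=> y ey; have [i [j /ey]] := surj_e y.
Qed.

(** * Euler's criterion and Zolotarev's lemma at a prime modulus *)

Lemma Fp_square_exists (p : nat) (a : int) : prime p ->
  [exists x : 'I_p, (p%:Z %| (x%:Z ^+ 2 - a))%Z]
  = [exists y : 'F_p, y ^+ 2 == a%:~R].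
Proof.
move=> p_pr; have chFp := pchar_Fp p_pr.
apply/existsP/existsP=> [[x]|[y /eqP y2]].
  rewrite (dvdz_pcharf chFp) rmorphB rmorphXn /= subr_eq0 => x2.
  by exists (x%:R).
have y_lt : (y < p)%N by have := ltn_ord y; rewrite [X in (_ < X)%N -> _]Fp_cast.
exists (Ordinal y_lt); rewrite (dvdz_pcharf chFp) rmorphB rmorphXn /= subr_eq0.
by rewrite -pmulrn natr_Zp y2.
Qed.

Lemma Fp_natr_inj (p i j : nat) : prime p -> (i < p)%N -> (j < p)%N ->
  i%:R = j%:R :> 'F_p -> i = j.
Proof.
move=> p_pr ip jp /(congr1 (@nat_of_ord _)).
by rewrite !val_Fp_nat // !modn_small.
Qed.

Lemma Fp_neg1_neq1 (p : nat) : prime p -> odd p -> (-1 : 'F_p) != 1.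
Proof.
move=> p_pr p_odd; rewrite eq_sym -subr_eq0 opprK.
have p2 : (2 < p)%N by have := prime_gt1 p_pr; lia.
have -> : 1 + 1 = 2%:R :> 'F_p by rewrite -mulr2n.
apply/eqP; change (0 : 'F_p) with (0%N%:R : 'F_p); move/Fp_natr_inj=> h.
have := h p_pr p2; lia.
Qed.

(** With h = (p - 1)/2, Fermat gives x^h = 1 or -1. For a non-residue x the value 1 is impossible:
    X^h - 1 would have the h + 1 distinct roots x, 1^2, ..., h^2. *)
Lemma legendre_euler (p : nat) (a : int) : prime p -> odd p -> ~~ (p%:Z %| a)%Z ->
  (legendre a p)%:~R = a%:~R ^+ (p.-1./2) :> 'F_p.
Proof.
move=> p_pr p_odd pa; rewrite /legendre (negPf pa) Fp_square_exists //.
have chFp := pchar_Fp p_pr.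
have p2 : (2 < p)%N by have := prime_gt1 p_pr; lia.
have fermat (y : 'F_p) : y != 0 -> y ^+ p.-1 = 1.
  move=> y0; apply: (mulfI y0); rewrite -exprS prednK ?mulr1; last lia.
  by have := expf_card y; rewrite card_Fp.
move def_h: (p.-1./2) => h.
have def_p : p = (2 * h)%N.+1 by lia.
have := pa; rewrite (dvdz_pcharf chFp); move: (a%:~R) => x x0.
case: existsP => [[y /eqP y2]|nsq].
  by rewrite -y2 sqrf_eq0 in x0; rewrite -y2 -exprM -[(2 * h)%N]/((2 * h).+1.-1)%N
    -def_p fermat.
have xh2 : (x ^+ h) ^+ 2 = 1.
  by rewrite -exprM mulnC -[(2 * h)%N]/((2 * h).+1.-1)%N -def_p fermat.
have xh1 : x ^+ h != 1.
  apply/eqP=> xh1.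
  pose sq := [seq (i%:R : 'F_p) ^+ 2 | i <- iota 1 h].
  have h0 : (0 < h)%N by lia.
  have sz : size ('X^h - 1 : {poly 'F_p}) = h.+1 by exact: size_XnsubC.
  have := @max_poly_roots _ ('X^h - 1 : {poly 'F_p}) (x :: sq).
  rewrite -size_poly_eq0 sz /= size_map size_iota ltnn => /(_ isT) absurd.
  suff: false by []; apply: absurd.
    rewrite /root !hornerE xh1 subrr eqxx /=.
    apply/allP=> z /mapP[i]; rewrite mem_iota => /andP[i1 ih] -> /=.
    rewrite !hornerE -exprM -[(2 * h)%N]/((2 * h).+1.-1)%N -def_p.
    rewrite fermat ?subrr //; apply/eqP.
    change (0 : 'F_p) with (0%N%:R : 'F_p); move/Fp_natr_inj=> i0.
    have := i0 p_pr; lia.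
  apply/andP; split.
    by apply/mapP=> [[i _ def_x]]; apply: nsq; exists i%:R; rewrite def_x.
  rewrite map_inj_in_uniq ?iota_uniq // => i j.
  rewrite !mem_iota => /andP[i1 ih] /andP[j1 jh] /eqP.
  rewrite eqf_sqr => /orP[/eqP/Fp_natr_inj-> //|]; try lia.
  (* The case i = -j is excluded because 0 < i + j < p. *)
  rewrite -subr_eq0 opprK -natrD => /eqP.
  change (0 : 'F_p) with (0%N%:R : 'F_p); move/Fp_natr_inj=> i0.
  have := i0 p_pr; lia.
by move/eqP: xh2; rewrite sqrf_eq1 (negPf xh1) /= => /eqP ->.
Qed.

(* Both sides agree in F_p: the sign is read off the Vandermonde determinant,
   each of whose p(p-1)/2 factors is multiplied by [a]. *)
Lemma zolotarev_prime (p a c : nat) (s : 'S_p) : prime p -> odd p ->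
  coprime a p -> (forall i : 'I_p, s i = ((a * i + c) %% p)%N :> nat) ->
  legendre a%:Z p = (-1) ^+ s.
Proof.
move=> p_pr p_odd co_ap sE.
have pa : ~~ (p%:Z %| a%:Z)%Z.
  by rewrite dvdzE /= -prime_coprime // coprime_sym.
have signE : ((-1) ^+ s : 'F_p) = a%:R ^+ (p.-1./2).
  pose V := Vandermonde p (\row_(i < p) (i%:R : 'F_p)).
  have V0 : \det V != 0.
    rewrite det_Vandermonde prodf_seq_neq0; apply/allP=> i _ /=.
    rewrite prodf_seq_neq0; apply/allP=> j _ /=; apply/implyP=> ij.
    rewrite !mxE subr_eq0; apply/eqP=> /Fp_natr_inj ji.
    have := ji p_pr (ltn_ord j) (ltn_ord i); lia.
  apply: (mulIf V0).
  have -> : (-1) ^+ s * \det V = \det (col_perm s V).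
    by rewrite col_permE det_mulmx det_perm odd_permV mulrC.
  have -> : col_perm s V = Vandermonde p (\row_(i < p) ((s i)%:R : 'F_p)).
    by apply/matrixP=> i j; rewrite !mxE.
  rewrite !det_Vandermonde.
  transitivity (\prod_(i < p) \prod_(j < p | (i < j)%N)
      ((a%:R : 'F_p) * (j%:R - i%:R))).
    apply: eq_bigr => i _; apply: eq_bigr => j _.
    rewrite !mxE !sE !Fp_nat_mod // !natrD !natrM; ring.
  under eq_bigr => i _ do rewrite big_split /=.
  rewrite big_split /=; congr (_ * _); last first.
    by apply: eq_bigr => i _; apply: eq_bigr => j _; rewrite !mxE.
  transitivity (\prod_(i < p) (a%:R : 'F_p) ^+ (p - i.+1)).
    apply: eq_bigr => i _.
    by rewrite -prodr_const_nat big_geq_mkord.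
  rewrite prodrXr.
  have -> : (\sum_(i < p) (p - i.+1) = p * p.-1./2)%N.
    rewrite (reindex_inj rev_ord_inj) /=.
    transitivity (\sum_(i < p) i)%N.
      by apply: eq_bigr => i _; have := ltn_ord i; lia.
    have p1E : p.-1 = (p.-1./2).*2 by lia.
    by rewrite -(big_mkord xpredT id) bin2_sum bin2 {1}p1E -doubleMr doubleK.
  (* a^p = a reduces the exponent p(p - 1)/2 to (p - 1)/2. *)
  by rewrite exprM; have := expf_card (a%:R : 'F_p); rewrite card_Fp // => ->.
(* Both sides are 1 or -1, which stay distinct in ['F_p] for odd p, so the equality lifts to the
   integers. *)
have := legendre_euler _ a%:Z p_pr p_odd pa; rewrite -pmulrn -signE.
have neg1 := Fp_neg1_neq1 _ p_pr p_odd.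
rewrite /legendre (negPf pa); case: ifP => _; case: (odd_perm s);
  rewrite /= ?expr0 ?expr1 ?rmorphN ?rmorph1 //= => /eqP.
- by rewrite eq_sym (negPf neg1).
- by rewrite (negPf neg1).
Qed.

(** * Affine permutations modulo n and the Jacobi symbol *)

Lemma affine_perm (n a c : nat) : (0 < n)%N -> coprime a n ->
  exists s : 'S_n, forall i : 'I_n, s i = ((a * i + c) %% n)%N :> nat.
Proof.
move=> n0 co_an; pose f (i : 'I_n) := Ordinal (ltn_pmod (a * i + c) n0).
have inj_f : injective f.
  move=> i j /(congr1 val) /= /eqP; rewrite eqn_modDr => eq_ij.
  apply: val_inj => /=; wlog le_ij : i j eq_ij / (i <= j)%N.
    move=> W; case/orP: (leq_total i j) => ?; first exact: W.
    by rewrite (W j i) // eq_sym.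
  move: eq_ij; rewrite eq_sym eqn_mod_dvd ?leq_mul2l ?le_ij ?orbT //.
  rewrite -mulnBr Gauss_dvdr 1?coprime_sym // => /dvdn_leq.
  have := ltn_ord j; lia.
by exists (perm inj_f) => i; rewrite permE.
Qed.

(** A range of primes independent of [n] lets the products for two moduli be compared factor by
    factor. *)
Lemma jacobi_bounded (a : int) (n N : nat) : (0 < n < N)%N ->
  jacobi a n = \prod_(0 <= p < N | prime p) legendre a p ^+ logn p n.
Proof.
case/andP=> n0 nN; rewrite /jacobi.
rewrite [RHS](bigID (fun p => p \in primes n)) /= [X in _ * X]big1 ?mulr1; last first.
  move=> p /andP[p_pr]; rewrite mem_primes lognE p_pr n0 /=.
  by move/negPf->; rewrite expr0.
rewrite -[RHS]big_filter; apply: perm_big; apply: uniq_perm.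
- exact: primes_uniq.
- by rewrite filter_uniq ?iota_uniq.
move=> p; rewrite mem_filter mem_index_iota mem_primes.
case: (prime p) => //=; rewrite n0 /=; case pn: (p %| n)%N => //=.
by have := dvdn_leq n0 pn; lia.
Qed.

Lemma jacobi_prime_mul (a : int) (p m : nat) : prime p -> (0 < m)%N ->
  jacobi a (p * m) = legendre a p * jacobi a m.
Proof.
move=> p_pr m0; have p0 := prime_gt0 p_pr.
have pm : (p <= p * m)%N by rewrite leq_pmulr.
have mp : (m <= p * m)%N by rewrite leq_pmull.
rewrite !(jacobi_bounded _ _ (p * m).+1) ?ltnS ?muln_gt0 ?p0 ?m0 ?leqnn //.
under eq_bigr => q _ do rewrite lognM // exprD.
rewrite big_split /=; congr (_ * _).
rewrite -big_filter (bigD1_seq p) /= ?filter_uniq ?iota_uniq //; last first.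
  by rewrite mem_filter p_pr mem_iota /=; lia.
rewrite logn_prime // eqxx expr1 big1_seq ?mulr1 // => q.
rewrite mem_filter => /andP[qp /andP[q_pr _]].
by rewrite logn_prime // (negPf qp) expr0.
Qed.

Lemma mul_add_mod_split (X p m r : nat) : (r < m)%N -> (0 < p)%N ->
  ((X * m + r) %% (p * m) = (X %% p) * m + r)%N.
Proof.
move=> rm p0; rewrite {1}(divn_eq X p) mulnDl -mulnA -addnA modnMDl modn_small //.
have := ltn_pmod X p0; nia.
Qed.

(** Induction on n = p m with p prime. In digits i m + j, the map is affine mod m on j and, above
    each j, affine mod p on i. As p and m are odd, its sign is the product of the signs mod p and
    mod m. *)
Lemma zolotarev (n a c : nat) (s : 'S_n) : odd n -> coprime a n ->
  (forall i : 'I_n, s i = ((a * i + c) %% n)%N :> nat) ->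
  jacobi a%:Z n = (-1) ^+ s.
Proof.
have [N leN] := ubnP n; elim: N => // N IHN in n leN a c s *.
move=> n_odd co_an sE.
have [n1|n1] := leqP n 1.
  have def_n : n = 1%N by lia.
  subst n; have -> : s = 1%g by apply/permP=> i; rewrite !ord1.
  by rewrite odd_perm1 /jacobi big_nil.
have [p p_pr /dvdnP[m def_n]] : exists2 p, prime p & (p %| n)%N.
  by exists (pdiv n); rewrite ?pdiv_prime ?pdiv_dvd.
have p0 := prime_gt0 p_pr; have p1 := prime_gt1 p_pr.
have m0 : (0 < m)%N by nia.
rewrite mulnC in def_n; subst n.
move: n_odd co_an; rewrite oddM coprimeMr => /andP[p_odd m_odd] /andP[co_ap co_am].
have e_lt (i : 'I_p) (j : 'I_m) : (i * m + j < p * m)%N.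
  by have := ltn_ord i; have := ltn_ord j; nia.
pose e i j := Ordinal (e_lt i j).
have inj_e i i' j j' : e i j = e i' j' -> i = i' /\ j = j'.
  move=> /(congr1 val) /= eq_e; split; apply: val_inj.
    have /= := congr1 (fun k => k %/ m)%N eq_e.
    by rewrite !divnMDl // !divn_small ?addn0.
  have /= := congr1 (fun k => k %% m)%N eq_e.
  by rewrite !modnMDl !modn_small.
have [g gE] := affine_perm m a c m0 co_am.
(* The carry of [a * j + c] past [m] translates the high digit by an amount depending on [j]; hence
   the free constant [c] in the statement. *)
have /fin_all_exists[f fE] (j : 'I_m) := affine_perm p a ((a * j + c) %/ m) p0 co_ap.
have f_sign j : legendre a%:Z p = (-1) ^+ f j.
  exact: (zolotarev_prime _ _ _ _ p_pr p_odd co_ap (fE j)).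
rewrite jacobi_prime_mul // (IHN m _ a c g) //; last by nia.
rewrite (odd_perm_wreath e f g s) //.
- rewrite card_ord p_odd /= signr_addb mulrC; congr (_ * _).
  (* All [f j] have the same sign, since the prime case gives a value independent of the
     translation. *)
  pose j0 := Ordinal m0; rewrite (eq_bigr (fun=> odd_perm (f j0))).
    by rewrite big_addb_const card_ord m_odd /= (f_sign j0).
  move=> j _; have := f_sign j; rewrite (f_sign j0).
  by case: (odd_perm _); case: (odd_perm _).
- move=> y; have yi : (y %/ m < p)%N by rewrite ltn_divLR.
  exists (Ordinal yi), (Ordinal (ltn_pmod y m0)).
  by apply: val_inj; rewrite /= -divn_eq.
move=> i j; apply: val_inj; rewrite /= sE fE gE /=.
rewrite -mul_add_mod_split ?ltn_pmod //; congr (_ %% _)%N.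
by have := divn_eq (a * j + c) m; nia.
Qed.

Lemma legendre_modz (a b : int) (p : nat) : (p%:Z %| a - b)%Z ->
  legendre a p = legendre b p.
Proof.
move=> pab; have dvdE x : (p%:Z %| x - a)%Z = (p%:Z %| x - b)%Z.
  by rewrite -[x - b](subrKA a) [RHS]rpredDr.
have dvdab : (p%:Z %| a)%Z = (p%:Z %| b)%Z by rewrite -[a](subrK b) rpredDl.

by rewrite /legendre dvdab; under eq_existsb => x do rewrite dvdE.
Qed.

Lemma jacobi_modz (a b : int) (n : nat) : (n%:Z %| a - b)%Z ->
  jacobi a n = jacobi b n.
Proof.
move=> nab; rewrite /jacobi; apply: eq_big_seq => p.
rewrite mem_primes => /and3P[_ _ pn]; rewrite (legendre_modz a b) //.
by apply: dvdz_trans nab; rewrite dvdzE.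
Qed.

Lemma jacobi_eq0 (a : int) (n p : nat) : (0 < n)%N -> prime p -> (p %| n)%N ->
  (p%:Z %| a)%Z -> jacobi a n = 0.
Proof.
move=> n0 p_pr pn pa; rewrite /jacobi (bigD1_seq p) ?primes_uniq //=; last first.
  by rewrite mem_primes p_pr n0.
rewrite /legendre pa; have := pn; rewrite -[p in (p %| _)%N]expn1.
by rewrite pfactor_dvdn //; case: (logn p n) => // l _; rewrite expr0n mul0r.
Qed.

Lemma zolotarevz (n : nat) (a c : int) (s : 'S_n) : odd n -> coprimez a n ->
  (forall i : 'I_n, (s i)%:Z = ((a * i%:Z + c) %% n)%Z) ->
  jacobi a n = (-1) ^+ s.
Proof.
move=> n_odd co_an sE; have n0 : (n%:Z != 0) by lia.
have natE (z : int) : exists2 z0 : nat, (z %% n)%Z = z0%:Z & (n%:Z %| z - z0%:Z)%Z.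
  exists `|(z %% n)%Z|%N; first by rewrite gez0_abs // modz_ge0.
  by rewrite gez0_abs ?modz_ge0 // /modz opprB addrC subrK dvdz_mull.
have [[a0 a0E ma] [c0 c0E mc]] := (natE a, natE c).
rewrite (jacobi_modz _ _ _ ma); apply: (zolotarev _ _ c0) => // [|i].
  by move: co_an; rewrite /coprimez -gcdz_modl a0E.
apply/eqP; rewrite -eqz_nat sE -modz_nat PoszD PoszM eqz_mod_dvd.
have -> : a * i%:Z + c - (a0%:Z * i%:Z + c0%:Z)
  = (a - a0%:Z) * i%:Z + (c - c0%:Z) by ring.
by rewrite rpredD // dvdz_mulr.
Qed.

Lemma affine_permz (n : nat) (a c : int) : (0 < n)%N -> coprimez a n ->
  exists s : 'S_n, forall i : 'I_n, (s i)%:Z = ((a * i%:Z + c) %% n)%Z.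
Proof.
move=> n_gt0 co_an; have n0 : (n%:Z != 0) by lia.
have lt_f (i : 'I_n) : (`|((a * i%:Z + c) %% n)%Z| < n)%N by lia.
pose f (i : 'I_n) := Ordinal (lt_f i).
have fE i : (f i)%:Z = ((a * i%:Z + c) %% n)%Z by rewrite /= gez0_abs ?modz_ge0.
have inj_f : injective f.
  move=> i j fij; have := fE i; rewrite fij fE => /eqP.
  rewrite eqz_mod_dvd.
  have -> : a * j%:Z + c - (a * i%:Z + c) = a * (j%:Z - i%:Z) by ring.
  rewrite Gauss_dvdzr 1?coprimez_sym // dvdzE /= => /dvdn_leq ji.
  apply: val_inj => /=; have := ltn_ord i; have := ltn_ord j; lia.
by exists (perm inj_f) => i; rewrite permE fE.
Qed.

(** * Determinants of rank-one perturbations *)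

(** Two triangular factorizations of the block matrix with rows (1, -v) and (w, 1) are compared. *)
Lemma det_1_add_rank1 {R : comNzRingType} {n : nat} (w : 'cV[R]_n) (v : 'rV[R]_n) :
  \det (1%:M + w *m v) = 1 + (v *m w) 0 0.
Proof.
have e1 : block_mx 1%:M (- v) w 1%:M
    = block_mx 1%:M 0 w 1%:M *m block_mx 1%:M (- v) 0 (1%:M + w *m v).
  rewrite mulmx_block !(mul1mx, mul0mx, mulmx0, mulmx1, addr0, add0r) mulmxN.
  by rewrite addrC addrK.
have e2 : block_mx 1%:M (- v) w 1%:M
    = block_mx (1%:M + v *m w) (- v) 0 1%:M *m block_mx 1%:M 0 w 1%:M.
  rewrite mulmx_block !(mul1mx, mul0mx, mulmx0, mulmx1, addr0, add0r) mulNmx.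
  by rewrite addrK.
have := congr1 determinant e1; rewrite e2 !det_mulmx !det_ublock !det_lblock.
by rewrite !det1 !mul1r !mulr1 det_mx11 !mxE => ->.
Qed.

(** A solution [w] of A w = c u does the work of the inverse of [A]: the perturbed matrix is A (1 +
    (x/c) w v). *)
Lemma det_rank1_update {R : fieldType} {n : nat} (A : 'M[R]_n) (u w : 'cV[R]_n)
    (v : 'rV[R]_n) (c x : R) : c != 0 -> A *m w = c *: u ->
  \det (A + x *: (u *m v)) = \det A * (1 + x / c * (v *m w) 0 0).
Proof.
move=> c0 Aw.
have -> : A + x *: (u *m v) = A *m (1%:M + (x / c) *: w *m v).
  rewrite mulmxDr mulmx1 mulmxA -scalemxAr Aw scalerA divfK //.
  by rewrite -scalemxAl.
by rewrite det_mulmx det_1_add_rank1 -scalemxAr [in RHS]mulrC !mxE mulrC.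
Qed.

(** Consecutive rows differ only on the diagonal, by 1 - y. So the matrix is the lower triangular
    all-ones [L] times [U], which holds the first row and then the row differences. *)
Lemma det_step {R : comNzRingType} (N : nat) (y : R) :
  \det (\matrix_(i < N.+1, j < N.+1) (if (i < j)%N then y else 1)) = (1 - y) ^+ N.
Proof.
pose L : 'M[R]_N.+1 := \matrix_(i, j) (j <= i)%N%:R.
pose U : 'M[R]_N.+1 := \matrix_(i, j)
  if i == 0 then (if j == 0 then 1 else y) else (1 - y) *+ (i == j).
have -> : (\matrix_(i < N.+1, j < N.+1) (if (i < j)%N then y else 1)) = L *m U.
  apply/matrixP=> i j; rewrite !mxE big_ord_recl !mxE /= mul1r.
  have [->|j0] := eqVneq j 0.
    rewrite ltn0 big1 ?addr0 // => k _; rewrite !mxE /=.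
    by rewrite mulr0n mulr0.
  have jN : (j.-1 < N)%N by have := ltn_ord j; move: j0; rewrite -val_eqE /=; lia.
  rewrite (bigD1 (Ordinal jN)) //= big1 ?addr0; last first.
    move=> k kj; rewrite !mxE /= -[lift _ _ == j]val_eqE /=.
    have -> : (bump 0 k == j) = false.
      move: kj j0; rewrite -!val_eqE /= /bump /=; lia.
    by rewrite mulr0n mulr0.
  rewrite !mxE /= -[lift _ _ == j]val_eqE /= /bump /= add1n.
  rewrite prednK; last by move: j0; rewrite -val_eqE /=; lia.
  rewrite eqxx mulr1n; case: ltnP => _ /=; by rewrite ?mul0r ?mul1r ?addr0 //; ring.
rewrite det_mulmx det_trig; last first.
  by apply/is_trig_mxP=> i j ij; rewrite mxE leqNgt ij.
rewrite big1 ?mul1r => [|i _]; last by rewrite mxE leqnn.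
rewrite -det_tr det_trig; last first.
  apply/is_trig_mxP=> i j ij; rewrite !mxE -!val_eqE /=.
  by case: (nat_of_ord j) ij => //= j' ij'; rewrite gtn_eqF.
rewrite big_ord_recl !mxE /= mul1r (eq_bigr (fun=> 1 - y)).
  by rewrite prodr_const card_ord.
by move=> i _; rewrite !mxE eqxx.
Qed.

(** The second factor of the summand is the vector w with A w = (1 - y) al for the step matrix A.
    Partial row sums are tracked on both sides of the diagonal for the induction; m = N gives the
    equation. *)
Lemma step_telescope {R : comNzRingType} (N r m : nat) (al : nat -> R) (y : R) :
  \sum_(s < m.+1) (if (r < s)%N then y else 1)
     * (al s - (if s == 0 :> nat then y * al N else al s.-1))
  = if (r < m)%N then al r - y * al N + y * (al m - al r) else al m - y * al N.
Proof.
elim: m => [|m IHm]; first by rewrite big_ord1 /= mul1r.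
rewrite big_ord_recr /= IHm ltnS; case: ltngtP => [rm|rm|->].
- by ring.
- by rewrite mul1r; ring.
- by ring.
Qed.

Lemma det_step_rank1 {R : fieldType} (N : nat) (al be : nat -> R) (x y : R) :
  y != 1 ->
  \det (\matrix_(i < N.+1, j < N.+1)
          ((if (i < j)%N then y else 1) + x * (al i * be j)))
  = (1 - y) ^+ N * (1 + x / (1 - y) * \sum_(s < N.+1)
      be s * (al s - (if s == 0 :> nat then y * al N else al s.-1))).
Proof.
move=> y1.
pose A : 'M[R]_N.+1 := \matrix_(i, j) (if (i < j)%N then y else 1).
pose u : 'cV[R]_N.+1 := \col_i al i.
pose v : 'rV[R]_N.+1 := \row_i be i.
pose w : 'cV[R]_N.+1 := \col_(s < N.+1)
  (al s - (if s == 0 :> nat then y * al N else al s.-1)).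
have -> : (\matrix_(i < N.+1, j < N.+1)
    ((if (i < j)%N then y else 1) + x * (al i * be j))) = A + x *: (u *m v).
  by apply/matrixP=> i j; rewrite !mxE big_ord1 !mxE.
rewrite (@det_rank1_update _ _ A u w v (1 - y) x).
- rewrite det_step mxE; congr (_ * (1 + _ * _)).
  by apply: eq_bigr => s _; rewrite !mxE.
- by rewrite subr_eq0 eq_sym.
apply/matrixP=> i j; rewrite !mxE.
under eq_bigr => s _ do rewrite !mxE.
rewrite step_telescope; case: ltnP => iN; first by ring.
have -> : nat_of_ord i = N by have := ltn_ord i; lia.
by ring.
Qed.

(** Up to the constant x the rows are R, t R, t^2 R. The coefficients t, -(1 + t), 1 annihilate
    these, and they sum to 0, so they annihilate the constant too. *)
Lemma det_three_rows {R : fieldType} {n : nat} (M : 'M[R]_n) (x t : R)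
    (i0 i1 i2 : 'I_n) : i2 != i0 -> i2 != i1 ->
  (forall k, M i1 k - x = t * (M i0 k - x)) ->
  (forall k, M i2 k - x = t * (M i1 k - x)) -> \det M = 0.
Proof.
move=> i20 i21 M1 M2; apply/eqP/det0P.
exists (t *: delta_mx 0 i0 - (1 + t) *: delta_mx 0 i1 + delta_mx 0 i2).
  apply/eqP=> /matrixP/(_ 0 i2); rewrite !mxE !eqxx (negPf i20) (negPf i21) /=.
  by rewrite !mulr0 subr0 add0r => /eqP; rewrite oner_eq0.
rewrite mulmxDl mulmxBl -!scalemxAl -!rowE; apply/matrixP=> i k; rewrite !mxE.
have -> : M i2 k = x + t * (M i1 k - x) by rewrite -M2; ring.
have -> : M i1 k = x + t * (M i0 k - x) by rewrite -M1; ring.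
by ring.
Qed.

(** * The lattice sum and its telescoping *)

(** The square [0, N]^2 and its shift by (1, 1) share [1, N]^2; on the rest of either one, [F]
    vanishes except at (0, 0) and (N+1, N+1). *)
Lemma sum_shift_square {R : comNzRingType} (N : nat) (F : nat -> nat -> R) :
  (forall i, (i < N)%N -> [/\ F 0%N i.+1 = 0, F i.+1 0%N = 0,
     F N.+1 i.+1 = 0 & F i.+1 N.+1 = 0]) ->
  \sum_(k < N.+1) (\sum_(j < N.+1) F j.+1 k.+1 - \sum_(j < N.+1) F j k)
  = F N.+1 N.+1 - F 0%N 0%N.
Proof.
move=> F0; rewrite sumrB.
have -> : \sum_(k < N.+1) \sum_(j < N.+1) F j.+1 k.+1
    = \sum_(k < N) \sum_(j < N) F j.+1 k.+1 + F N.+1 N.+1.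
  rewrite big_ord_recr /=; congr (_ + _).
    by apply: eq_bigr => k _; rewrite big_ord_recr /=; case: (F0 k) => // _ _ ->;
      rewrite addr0.
  by rewrite big_ord_recr /= big1 ?add0r // => j _; case: (F0 j).
have -> : \sum_(k < N.+1) \sum_(j < N.+1) F j k
    = F 0%N 0%N + \sum_(k < N) \sum_(j < N) F j.+1 k.+1.
  rewrite big_ord_recl /=; congr (_ + _).
    by rewrite big_ord_recl /= big1 ?addr0 // => j _; case: (F0 j).
  by apply: eq_bigr => k _; rewrite big_ord_recl /=; case: (F0 k) => // ->;
    rewrite add0r.
by ring.
Qed.

Lemma exprz_sum {R : fieldType} {I : finType} (q : R) (f : I -> int) : q != 0 ->
  \prod_i q ^ f i = q ^ (\sum_i f i).
Proof.
move=> q0; rewrite (big_morph (fun z => q ^ z) (id1 := 1) (op1 := *%R)) //.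
by move=> m n; rewrite expfzDr.
Qed.

(** If a j = u n + r and (a+1) k = v n + s with r = s, the weight is q^(v-u). The value 0 elsewhere
    turns sums over matching remainders into sums over a full square. *)
Definition lattice_weight {R : fieldType} (q : R) (a : int) (n j k : nat) : R :=
  let m := (a + 1) * k%:Z - a * j%:Z in
  if (n%:Z %| m)%Z then q ^ (m %/ n)%Z else 0.

Lemma lattice_weightE {R : fieldType} (q : R) (a : int) (n j k : nat) (E : int) :
  (0 < n)%N ->
  (a + 1) * k%:Z - a * j%:Z = E * n%:Z ->
  lattice_weight q a n j k = q ^ E.
Proof.
by move=> n0 def_E; rewrite /lattice_weight def_E dvdz_mull // mulzK //; lia.
Qed.

(** As [a] is prime to [n], each [k] has a single lattice point among [n] consecutive values of j;
    the window starts at [c], later taken to be 1 or 0. *)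
Lemma lattice_weight_row {R : fieldType} (q : R) (a : int) (n c k : nat)
    (j0 : 'I_n) (E : int) : coprimez a n ->
  (a + 1) * k%:Z - a * (c + j0)%N%:Z = E * n%:Z ->
  \sum_(j < n) lattice_weight q a n (c + j) k = q ^ E.
Proof.
move=> co_a def_E; have n0 : (0 < n)%N by have := ltn_ord j0; lia.
rewrite (bigD1 j0) //= (lattice_weightE _ _ _ _ _ _ n0 def_E) big1 ?addr0 //.
move=> j jj0; rewrite /lattice_weight; case: ifP => // nj; case/negP: jj0.
have: (n%:Z %| a * (j%:Z - j0%:Z))%Z.
  have -> : a * (j%:Z - j0%:Z) = E * n%:Z - ((a + 1) * k%:Z - a * (c + j)%N%:Z).
    by rewrite -def_E !PoszD; ring.
  by rewrite rpredB // dvdz_mull.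
rewrite Gauss_dvdzr 1?coprimez_sym // dvdzE /= => /dvdn_leq ji.
by apply/eqP/val_inj => /=; have := ltn_ord j; have := ltn_ord j0; lia.
Qed.

(** On an edge one coordinate is 0 mod n, so a lattice point there would make n divide a i or (a+1)
    i. *)
Lemma lattice_weight_boundary {R : fieldType} (q : R) (a : int) (n i : nat) :
  coprimez a n -> coprimez (a + 1) n -> (0 < i < n)%N ->
  let F := lattice_weight q a n in
  [/\ F 0%N i = 0, F i 0%N = 0, F n i = 0 & F i n = 0].
Proof.
move=> co_a co_a1 /andP[i0 i_n] F.
have ndvd (b : int) : coprimez b n -> (n%:Z %| b * i%:Z)%Z = false.
  move=> co_b; rewrite Gauss_dvdzr 1?coprimez_sym // dvdzE /=.
  by apply/negP=> /dvdn_leq; lia.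
have n_l b : (n%:Z %| b * n%:Z)%Z by rewrite dvdz_mull.
rewrite /F /lattice_weight !mulr0 subr0 sub0r (ndvd _ co_a1) rpredN (ndvd _ co_a).
by rewrite rpredBr // rpredBl // (ndvd _ co_a1) (ndvd _ co_a).
Qed.

(** Only two corners survive: (n, n) has weight q and (0, 0) has weight 1. *)
Lemma lattice_weight_sum {R : fieldType} (q : R) (a : int) (n : nat) :
  (0 < n)%N -> coprimez a n -> coprimez (a + 1) n ->
  let F := lattice_weight q a n in
  \sum_(k < n) (\sum_(j < n) F j.+1 k.+1 - \sum_(j < n) F j k) = q - 1.
Proof.
move=> n0 co_a co_a1 F.
have [N def_n] : exists N, n = N.+1 by exists n.-1; lia.
have Fb i := lattice_weight_boundary q a n i co_a co_a1.
rewrite [in LHS]def_n sum_shift_square => [|i iN]; last first.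
  by rewrite -def_n; apply: Fb; lia.
rewrite -def_n /F (lattice_weightE _ _ _ _ _ 1) //; last by ring.
by rewrite (lattice_weightE _ _ _ _ _ 0) ?expr0z ?expr1z //; ring.
Qed.

(** Put i = s k. The two products in the summand are the weights of the only lattice points with
    second coordinate k + 1 and k in their windows, hence the two inner sums of the telescoping
    identity. *)
Lemma step_sum {R : fieldType} (q : R) (a : int) (n N : nat) (r s : 'S_n)
    (u v : 'I_n -> int) (al be : nat -> R) :
  q != 0 -> n = N.+1 -> coprimez a n -> coprimez (a + 1) n ->
  (forall j : 'I_n, a * j.+1%:Z = u j * n%:Z + (r j)%:Z) ->
  (forall k : 'I_n, (a + 1) * k.+1%:Z = v k * n%:Z + (s k)%:Z) ->
  (forall j : 'I_n, al (r j) = q ^ (- u j)) ->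
  (forall k : 'I_n, be (s k) = q ^ v k) ->
  \sum_(i < n) be i * (al i - (if i == 0 :> nat then q^-1 * al N else al i.-1))
  = q - 1.
Proof.
move=> q0 def_n co_a co_a1 uE vE alE beE.
have n0 : (0 < n)%N by lia.
rewrite -(lattice_weight_sum q a n) // (reindex_inj (@perm_inj _ s)).
apply: eq_bigr => k _; rewrite mulrBr beE; congr (_ - _).
  pose j0 := (r^-1)%g (s k); have rj0 : r j0 = s k by rewrite permKV.
  rewrite -rj0 alE -expfzDr //.
  rewrite -(lattice_weight_row q a n 1 k.+1 j0 (v k - u j0)) //.
  by rewrite add1n uE vE rj0; ring.
(* [t] is the cyclic predecessor of [s k]. When [s k] is 0, wrapping to [N] lowers the quotient by
   one, which the factor [q^-1] records. *)
pose t : nat := if s k == 0 :> nat then N else (s k).-1.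
have tn : (t < n)%N by rewrite /t; have := ltn_ord (s k); case: ifP; lia.
pose j0 := (r^-1)%g (Ordinal tn).
have rj0 : r j0 = t :> nat by rewrite permKV.
have -> : (if s k == 0 :> nat then q^-1 * al N else al (s k).-1)
    = q ^ (- u j0 - (s k == 0 :> nat)%:Z).
  rewrite expfzDr // -alE rj0 /t; case: eqP => _.
    by rewrite mulrC -exprN1.
  by rewrite oppr0 expr0z mulr1.
rewrite -expfzDr // -(lattice_weight_row q a n 0 k j0
  (v k + (- u j0 - (s k == 0 :> nat)%:Z))) //.
rewrite add0n; have := uE j0; have := vE k.
rewrite rj0 -(addn1 k) -(addn1 j0) !PoszD => h1 h2.
have -> : (a + 1) * k%:Z - a * j0%:Z
    = (a + 1) * (k%:Z + 1) - a * (j0%:Z + 1) - 1 by ring.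
rewrite h1 h2 /t; case: eqP => [->|/eqP sk0].
  have -> : n%:Z = N%:Z + 1 by lia.
  by rewrite /= -[0%N%:Z]/(0 : int) -[1%N%:Z]/(1 : int); ring.
have -> : (s k : int) = (s k).-1%:Z + 1 by move: sk0; lia.
by rewrite /= -[0%N%:Z]/(0 : int); ring.
Qed.

(** * Exponents, and the determinant for a and a + 1 prime to n *)

(** The borrow when r < s is the source of the step matrix: it puts 1/q above the diagonal once rows
    and columns are sorted by remainder. *)
Lemma floorz_sub (n : nat) (u v : int) (r s : 'I_n) :
  floorz (u * n%:Z + r%:Z - (v * n%:Z + s%:Z)) n
  = u - v - (r < s)%N%:Z.
Proof.
have n0 : n%:Z != 0 by have := ltn_ord r; lia.
rewrite /floorz; have [rs|sr] := ltnP r s.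
  have -> : u * n%:Z + r%:Z - (v * n%:Z + s%:Z)
    = (u - v - 1) * n%:Z + (n%:Z + r%:Z - s%:Z) by ring.
  rewrite divzMDl // divz_small ?addr0 //.
  by have := ltn_ord s; have := ltn_ord r; lia.
have -> : u * n%:Z + r%:Z - (v * n%:Z + s%:Z)
  = (u - v) * n%:Z + (r%:Z - s%:Z) by ring.
rewrite divzMDl // divz_small ?addr0 ?subr0 //.
by have := ltn_ord s; have := ltn_ord r; lia.
Qed.

(** Summed over all indices, the remainders of the two families have the same total and cancel. This
    fixes the overall power of q. *)
Lemma sum_quotients (n : nat) (a b : int) (r s : 'S_n) (u v : 'I_n -> int) :
  odd n ->
  (forall j : 'I_n, a * j.+1%:Z = u j * n%:Z + (r j)%:Z) ->
  (forall k : 'I_n, b * k.+1%:Z = v k * n%:Z + (s k)%:Z) ->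
  \sum_j u j - \sum_k v k = (a - b) * (n.+1./2)%:Z.
Proof.
move=> n_odd uE vE; have n0 : n%:Z != 0 by lia.
have perm_sum (t : 'S_n) : \sum_j (t j)%:Z = \sum_(j < n) j%:Z.
  by rewrite [RHS](reindex_inj (@perm_inj _ t)).
have sumE (c : int) (t : 'S_n) (w : 'I_n -> int) :
    (forall j : 'I_n, c * j.+1%:Z = w j * n%:Z + (t j)%:Z) ->
    (\sum_j w j) * n%:Z = c * (\sum_(j < n) j.+1%:Z) - \sum_(j < n) j%:Z.
  move=> wE; rewrite mulr_suml mulr_sumr -(perm_sum t) -sumrB.
  by apply: eq_bigr => j _; rewrite wE addrK.
have gauss : \sum_(j < n) j.+1%:Z = (n.+1./2)%:Z * n%:Z.
  have -> : \sum_(j < n) j.+1%:Z = ('C(n.+1, 2))%:Z.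
    by rewrite -bin2_sum big_mkord big_ord_recl add0n (big_morph Posz PoszD (erefl _)).
  rewrite bin2 /= -PoszM; congr Posz.
  have -> : n.+1 = (n.+1./2).*2 by lia.
  by rewrite -doubleMl !doubleK.
apply: (mulIf n0); rewrite mulrBl (sumE _ _ _ uE) (sumE _ _ _ vE) gauss.
by ring.
Qed.

Lemma det_floor_coprime {R : fieldType} (a : int) (n : nat) (x q : R) :
  odd n -> coprimez a n -> coprimez (a + 1) n -> q != 0 -> q != 1 ->
  \det (\matrix_(j < n, k < n)
          (x + q ^ floorz (a * (j.+1)%:Z - (a + 1) * (k.+1)%:Z) n))
    = (jacobi (a * (a + 1)) n)%:~R * q ^ (- ((3 * n).-1./2)%:Z)
        * (1 - q) ^+ n.-1 * (1 + q * x).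
Proof.
move=> n_odd co_a co_a1 q0 q1; have n0 : (0 < n)%N by lia.
have nz : n%:Z != 0 by lia.
(* Indices start at 0, so the multiple a (j + 1) is the affine image a j + a. *)
have [r rE] := affine_permz n a a n0 co_a.
have [s sE] := affine_permz n (a + 1) (a + 1) n0 co_a1.
pose u (j : 'I_n) := ((a * j.+1%:Z) %/ n)%Z.
pose v (k : 'I_n) := (((a + 1) * k.+1%:Z) %/ n)%Z.
have shiftE (c : int) (j : nat) : c * j.+1%:Z = c * j%:Z + c.
  by rewrite -addn1 PoszD; ring.
have uE (j : 'I_n) : a * j.+1%:Z = u j * n%:Z + (r j)%:Z.
  by rewrite rE -shiftE -divz_eq.
have vE (k : 'I_n) : (a + 1) * k.+1%:Z = v k * n%:Z + (s k)%:Z.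
  by rewrite sE -shiftE -divz_eq.
have jacE : jacobi (a * (a + 1)) n = (-1) ^+ r * (-1) ^+ s.
  (* [r] followed by [s] is affine with multiplier a (a + 1), so the two signs combine into one
     Jacobi symbol. *)
  rewrite -signr_addb -odd_permM.
  apply: (zolotarevz _ _ (a * (a + 1) + (a + 1))) => // [|i].
    by rewrite coprimezMl co_a.
  rewrite permM sE rE; apply/eqP; rewrite eqz_mod_dvd.
  have := divz_eq (a * i%:Z + a) n; set m := ((_ %% _)%Z).
  set Q := ((_ %/ _)%Z) => mE.
  have -> : (a + 1) * m + (a + 1) - (a * (a + 1) * i%:Z + (a * (a + 1) + (a + 1)))
    = (a + 1) * (m - (a * i%:Z + a)) by ring.
  have -> : m - (a * i%:Z + a) = - Q * n%:Z by rewrite mE; ring.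
  by rewrite mulrA dvdz_mull.
have [N def_n] : exists N, n = N.+1 by exists n.-1; lia.
clear rE sE; subst n.
(* The weights that x acquires when the diagonal factors q^u and q^(-v) are pulled out, indexed by
   remainder. *)
pose al (i : nat) := q ^ (- u ((r^-1)%g (inord i))).
pose be (i : nat) := q ^ (v ((s^-1)%g (inord i))).
have alE j : al (r j) = q ^ (- u j) by rewrite /al inord_val permK.
have beE k : be (s k) = q ^ v k by rewrite /be inord_val permK.
pose K : 'M[R]_N.+1 := \matrix_(i, j)
  ((if (i < j)%N then q^-1 else 1) + x * (al i * be j)).
have -> : (\matrix_(j < N.+1, k < N.+1)
          (x + q ^ floorz (a * (j.+1)%:Z - (a + 1) * (k.+1)%:Z) N.+1))
   = diag_mx (\row_j q ^ u j) *m row_perm r (col_perm s K)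
       *m diag_mx (\row_k q ^ (- v k)).
  apply/matrixP=> j k; rewrite mul_mx_diag mul_diag_mx !mxE uE vE floorz_sub.
  rewrite alE beE !expfzDr // mulrDr mulrDl [RHS]addrC; congr (_ + _).
    rewrite [x * _]mulrCA !mulrA -expfzDr // subrr expr0z mul1r.
    by rewrite -mulrA -expfzDr // subrr expr0z mulr1.
  rewrite mulrAC; congr (_ * _ * _); by case: (_ < _)%N.
rewrite !det_mulmx !det_diag row_permE col_permE !det_mulmx !det_perm odd_permV.
under eq_bigr => j _ do rewrite mxE.
under [X in _ * X]eq_bigr => j _ do rewrite mxE.
rewrite !exprz_sum // det_step_rank1; last first.
  by apply: contraNneq q1 => q1; rewrite -[q]invrK q1 invr1.
rewrite (step_sum q a N.+1 N r s u v al be) // jacE rmorphM !rmorphXn rmorphN1.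
have -> : \sum_k (- v k) = - \sum_k v k by rewrite sumrN.
have expE := sum_quotients _ _ _ _ _ _ _ n_odd uE vE.
have [h def_h] : exists h, N = h.*2 by exists N./2; lia.
have -> : 1 + x / (1 - q^-1) * (q - 1) = 1 + q * x.
  have q1' : q - 1 != 0 by rewrite subr_eq0.
  by field; rewrite q0 q1'.
transitivity ((-1) ^+ r * (-1) ^+ s * (q ^ (\sum_j u j - \sum_k v k)
    * (1 - q^-1) ^+ N) * (1 + q * x)).
  rewrite expfzDr //; move: (q ^ (\sum_j u j)) (q ^ (- \sum_k v k)) => A B.
  move: ((-1) ^+ r : R) ((-1) ^+ s : R) ((1 - q^-1) ^+ N) => C D E.
  by move: (1 + q * x) => G; clear; ring.
suff -> : q ^ (\sum_j u j - \sum_k v k) * (1 - q^-1) ^+ N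
    = q ^ (- ((3 * N.+1).-1./2)%:Z) * (1 - q) ^+ N by rewrite /= !mulrA.
rewrite expE.
(* With n = 2h + 1 and N = 2h, the quotients contribute -(h + 1) and (1 - 1/q)^N contributes -N to
   the exponent, in total (1 - 3n)/2. N is even, so no sign appears. *)
have -> : (a - (a + 1)) * (N.+2./2)%:Z = - h.+1%:Z by lia.
have -> : ((3 * N.+1).-1./2 = h.+1 + N)%N by lia.
have -> : 1 - q^-1 = - ((1 - q) * q^-1) by field.
rewrite -!exprnN exprNn def_h -signr_odd odd_double expr0 mul1r exprMn exprVn.
by rewrite [in RHS]exprD invfM mulrCA mulrC.
Qed.

(** * Common factors with n, and the two identities in general *)

Lemma not_coprimez_prime (a : int) (n : nat) : odd n -> ~~ coprimez a n ->
  exists p m : nat, exists b : int,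
    [/\ prime p, n = (p * m)%N, a = b * p%:Z & (2 < p)%N].
Proof.
move=> n_odd nco; have n0 : (0 < n)%N by lia.
pose g := gcdn `|a| n; have g1 : (1 < g)%N.
  have: (0 < g)%N by rewrite gcdn_gt0 n0 orbT.
  by move: nco; rewrite coprimezE /coprime -/g /=; lia.
have p_pr := pdiv_prime g1; set p := pdiv g in p_pr.
have pg : (p %| g)%N := pdiv_dvd g.
have /dvdnP[m def_n] : (p %| n)%N := dvdn_trans pg (dvdn_gcdr _ _).
have /dvdzP[b def_a] : (p%:Z %| a)%Z.
  by rewrite dvdzE /=; apply: dvdn_trans pg (dvdn_gcdl _ _).
exists p, m, b; split=> //; first by rewrite mulnC.
have := prime_gt1 p_pr; have : odd p by move: n_odd; rewrite def_n oddM => /andP[].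
by case: (p) => [|[|[|]]].
Qed.

(** p >= 3 leaves room for the rows 0, m and 2m. *)
Lemma det_proportional_rows {R : fieldType} (n p m : nat) (M : 'M[R]_n) (x t : R) :
  n = (p * m)%N -> (2 < p)%N -> (0 < m)%N ->
  (forall i j k : 'I_n, i = (j + m)%N :> nat -> M i k - x = t * (M j k - x)) ->
  \det M = 0.
Proof.
move=> def_n p2 m0 Mt.
have i0n : (0 < n)%N by nia.
have i1n : (m < n)%N by nia.
have i2n : (m + m < n)%N by nia.
apply: (@det_three_rows _ _ M x t (Ordinal i0n) (Ordinal i1n) (Ordinal i2n)).
- by rewrite -val_eqE /=; lia.
- by rewrite -val_eqE /=; lia.
- by move=> k; apply: Mt.
- by move=> k; apply: Mt.
Qed.

Lemma det_floor {R : fieldType} (a : int) (n : nat) (x q : R) :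
  odd n -> q != 0 ->
  \det (\matrix_(j < n, k < n)
          (x + q ^ floorz (a * (j.+1)%:Z - (a + 1) * (k.+1)%:Z) n))
    = (jacobi (a * (a + 1)) n)%:~R * q ^ (- ((3 * n).-1./2)%:Z)
        * (1 - q) ^+ n.-1 * (1 + q * x).
Proof.
move=> n_odd q0; have n0 : (0 < n)%N by lia.
have nz : n%:Z != 0 by lia.
have [co_a|nco] := boolP (coprimez a n); last first.
  have [p [m [b [p_pr def_n def_a p2]]]] := not_coprimez_prime a n n_odd nco.
  rewrite (jacobi_eq0 _ _ p) // ?def_n ?dvdn_mulr -?def_n //; last first.
    by rewrite def_a dvdz_mulr // dvdz_mull.
  (* With a = b p and n = p m, raising j by m adds a m = b n to the numerator, so the floor grows by
     b. *)
  rewrite !mul0r; apply: (det_proportional_rows n p m _ x (q ^ b)) => //.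
    by move: n0; rewrite def_n; case: (m); rewrite ?muln0.
  move=> i j k ij; rewrite !mxE -!addrA ![x + (_ - x)]addrC !subrK -expfzDr //.
  congr (_ ^ _); rewrite /floorz -divzMDl //; congr (_ %/ _)%Z.
  have -> : n%:Z = p%:Z * m%:Z by rewrite -PoszM -def_n.
  by rewrite ij -addSn PoszD def_a; ring.
have [co_a1|nco] := boolP (coprimez (a + 1) n); last first.
  have [p [m [b [p_pr def_n def_a p2]]]] := not_coprimez_prime (a + 1) n n_odd nco.
  rewrite (jacobi_eq0 _ _ p) // ?def_n ?dvdn_mulr -?def_n //; last first.
    by rewrite def_a dvdz_mull // dvdz_mull.
  (* For a + 1 the shift acts on columns and lowers the floor by b. *)
  rewrite -det_tr !mul0r; apply: (det_proportional_rows n p m _ x (q ^ - b)) => //.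
    by move: n0; rewrite def_n; case: (m); rewrite ?muln0.
  move=> i j k ij; rewrite !mxE -!addrA ![x + (_ - x)]addrC !subrK -expfzDr //.
  congr (_ ^ _); rewrite /floorz -divzMDl //; congr (_ %/ _)%Z.
  have -> : n%:Z = p%:Z * m%:Z by rewrite -PoszM -def_n.
  by rewrite ij -addSn PoszD def_a; ring.
(* At q = 1 the denominator 1 - 1/q of the rank-one formula vanishes. All entries are then x + 1,
   and either n = 1 or n >= 3 gives three equal rows. *)
have [q1|q1] := eqVneq q 1; last exact: det_floor_coprime.
have [n1|n1] := eqVneq n 1%N.
  rewrite n1 det_mx11 !mxE q1 !exp1rz /jacobi big_nil rmorph1 /=.
  by rewrite !mul1r addrC.
rewrite q1 subrr expr0n; have -> : (n.-1 == 0)%N = false by lia.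
rewrite mulr0 mul0r.
apply: (det_proportional_rows n n 1 _ x 1); rewrite ?muln1 //; first by lia.
by move=> i j k _; rewrite !mxE !exp1rz mul1r.
Qed.

Theorem theorem1p3 (R : fieldType) (a : int) (n : nat)
  (hn0 : (0 < n)%N) (hnodd : odd n) (x q : R) (hq : q != 0) :
  \det (\matrix_(j < n, k < n)
          (x + q ^ floorz (a * (j.+1)%:Z - (a + 1) * (k.+1)%:Z) n))
    = (jacobi (a * (a + 1)) n)%:~R * q ^ (- ((3 * n).-1./2)%:Z)
        * (1 - q) ^+ n.-1 * (1 + q * x)
  /\
  \det (\matrix_(j < n, k < n)
          (x + q ^ ceilz ((a + 1) * (j.+1)%:Z - a * (k.+1)%:Z) n))
    = (jacobi (a * (a + 1)) n)%:~R * q ^+ (n.-1./2)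
        * (1 - q) ^+ n.-1 * (x + q).
Proof.
split; first exact: det_floor.
have qV0 : q^-1 != 0 by rewrite invr_eq0.
rewrite -det_tr.
(* The ceiling of z is minus the floor of -z, which inverts q; transposing puts a back on rows and a
   + 1 on columns. *)
have -> : (\matrix_(j < n, k < n)
      (x + q ^ ceilz ((a + 1) * (j.+1)%:Z - a * (k.+1)%:Z) n))^T
  = \matrix_(j < n, k < n)
      (x + q^-1 ^ floorz (a * (j.+1)%:Z - (a + 1) * (k.+1)%:Z) n).
  by apply/matrixP=> j k; rewrite !mxE /ceilz /floorz opprB exprz_inv.
rewrite det_floor //.
have [h def_n] : exists h, n = h.*2.+1 by exists n./2; lia.
(* The powers of q combine to (3h + 1) - 2h - 1 = h = (n - 1)/2. *)
have -> : ((3 * n).-1./2 = h + h.*2.+1)%N by lia.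
rewrite def_n /= doubleK exprz_inv opprK.
have -> : 1 - q^-1 = - ((1 - q) * q^-1) by field.
rewrite exprNn -signr_odd odd_double expr0 mul1r exprMn exprVn.
have -> : 1 + q^-1 * x = (x + q) * q^-1 by field.
rewrite -exprnP exprD exprSr.
have qh : q ^+ h.*2 != 0 by rewrite expf_neq0.
by field; rewrite hq qh.
Qed.
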